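(* Let $M$ be a $\mathfrak g$-module that is free of rank $1$ when viewed as a $U(\mathbb CL_0)$-module. Then $M\cong\Omega(\lambda,\overline\alpha)$ as $\mathfrak g$-modules for some $\lambda\in\mathbb C^\times$ and $\overline\alpha\in\mathbb C^p$.
   Context: All vector spaces and algebras are over $\mathbb C$; $\mathbb C^\times=\mathbb C\setminus\{0\}$; $p>1$ is a fixed integer. Gap-$p$ Virasoro algebra. $\mathfrak g$ is the Lie algebra with basis $\{L_n, I_n^{(i)}, C_j : n\in\mathbb Z, 1\le i\le p-1, 0\le j\le \lfloor p/2\rfloor\}$ and brackets $[L_m,L_n]=(m-n)L_{m+n}+\frac1{12}(m^3-m)\delta_{m+n,0}C_0$, $[I_m^{(i)},I_n^{(j)}]=(m+\frac ip)\delta_{i+j,p}\delta_{m+n+1,0}C_i$, $[L_m,I_n^{(i)}]=-(n+\frac ip)I_{m+n}^{(i)}$, all $C_k$ central; one sets $C_i:=C_{p-i}$ for $\lfloor p/2\rfloor<i\le p-1$. For $\lambda\in\mathbb C^\times$ and $\overline\alpha=(\alpha_0,\alpha_1,\dots,\alpha_{p-1})\in\mathbb C^p$, $\Omega(\lambda,\overline\alpha)$ denotes the $\mathfrak g$-module on the polynomial ring $\mathbb C[t]$ with $$L_nf(t)=\lambda^n(t+\alpha_0n)f(t+n),\quad I_n^{(i)}f(t)=\alpha_i\lambda^nf\bigl(t+n+\tfrac ip\bigr),\quad C_jf(t)=0,$$ for $n\in\mathbb Z$, $1\le i\le p-1$, $0\le j\le p-1$, $f(t)\in\mathbb C[t]$.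 *)

(* Defs.v *)
From HB Require Import structures.
From mathcomp Require Import all_boot all_order all_algebra.
From mathcomp Require Import finmap reals complex.
From mathcomp.multinomials Require Import monalg.
From mathcomp Require Import ring.

Set Implicit Arguments.
Unset Strict Implicit.
Unset Printing Implicit Defensive.

Import Order.TTheory GRing.Theory Num.Theory.
Local Open Scope ring_scope.

(** * Lie algebras and their modules *)

HB.mixin Record Lmodule_isLieAlgebra (K : comNzRingType) g of GRing.Lmodule K g := {
  lie_bracket : g -> g -> g;
  lie_linearl : forall y, linear (lie_bracket^~ y);
  lie_linearr : forall x, linear (lie_bracket x);
  lie_alternating : forall x, lie_bracket x x = 0;
  lie_jacobi : forall x y z,
    lie_bracket x (lie_bracket y z) + lie_bracket y (lie_bracket z x)
      + lie_bracket z (lie_bracket x y) = 0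
}.
#[short(type="lieAlgType")]
HB.structure Definition LieAlgebra (K : comNzRingType) :=
  { g of GRing.Lmodule K g & Lmodule_isLieAlgebra K g }.

Notation "[ 'lie' x , y ]" := (lie_bracket x y)
  (at level 0, x, y at level 99, format "[ 'lie'  x ,  y ]") : ring_scope.

HB.mixin Record Lmodule_isLieModule (K : comNzRingType) (g : lieAlgType K) M
    of GRing.Lmodule K M := {
  lie_act : g -> M -> M;
  lie_act_linearl : forall v, linear (lie_act^~ v);
  lie_act_linearr : forall x, linear (lie_act x);
  lie_act_bracket : forall x y v,
    lie_act [lie x, y] v = lie_act x (lie_act y v) - lie_act y (lie_act x v)
}.
#[short(type="lieModType")]
HB.structure Definition LieModule (K : comNzRingType) (g : lieAlgType K) :=
  { M of GRing.Lmodule K M & Lmodule_isLieModule K g M }.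

HB.instance Definition _ (K : comNzRingType) (g : lieAlgType K) (x : g) :=
  GRing.isLinear.Build K g g _ (lie_bracket x) (lie_linearr x).
HB.instance Definition _ (K : comNzRingType) (g : lieAlgType K)
    (M : lieModType g) (x : g) :=
  GRing.isLinear.Build K M M _ (@lie_act K g M x) (lie_act_linearr x).

Definition lie_module_iso (K : comNzRingType) (g : lieAlgType K)
    (M N : lieModType g) : Prop :=
  exists phi : {linear M -> N},
    bijective phi /\ forall (x : g) (v : M), phi (lie_act x v) = lie_act x (phi v).

Definition free_rank1 (A : nzRingType) (N : lmodType A) : Prop :=
  exists v : N, bijective (fun a : A => a *: v).

(** * Universal enveloping algebras *)

Definition lie_algebra_hom (K : comNzRingType) (g h : lieAlgType K)
    (f : g -> h) : Prop :=
  forall x y, f [lie x, y] = [lie f x, f y].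

(* A linear map into an associative algebra that is a Lie morphism for the
   commutator bracket. *)
Definition lie_to_assoc (K : comNzRingType) (g : lieAlgType K) (A : algType K)
    (f : g -> A) : Prop :=
  forall x y, f [lie x, y] = f x * f y - f y * f x.

Definition is_enveloping_algebra (K : comNzRingType) (g : lieAlgType K)
    (U : algType K) (iota : {linear g -> U}) : Prop :=
  lie_to_assoc iota /\
  forall (A : algType K) (f : {linear g -> A}), lie_to_assoc f ->
    exists F : {lrmorphism U -> A},
      (forall x, F (iota x) = f x) /\
      (forall F' : {lrmorphism U -> A}, (forall x, F' (iota x) = f x) -> F' =1 F).

(** * The Lie algebra [K x] and its enveloping algebra [K[x]] *)

(* The one-dimensional Lie algebra [K x] spanned by an element [x] (nonzero, in
   the cases of interest); the scalar [c] stands for [c x]. *)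
Definition lie_line (K : comNzRingType) (g : lieAlgType K) (x : g) : Type := K^o.

Section LieLine.
Variables (K : comNzRingType) (g : lieAlgType K) (x : g).

HB.instance Definition _ := GRing.Lmodule.on (lie_line x).

Definition lie_line_bracket (_ _ : lie_line x) : lie_line x := 0.

Fact lie_line_linearl (c : lie_line x) : linear (lie_line_bracket^~ c).
Proof. by move=> a u v; rewrite /lie_line_bracket scaler0 addr0. Qed.
Fact lie_line_linearr (c : lie_line x) : linear (lie_line_bracket c).
Proof. by move=> a u v; rewrite /lie_line_bracket scaler0 addr0. Qed.
Fact lie_line_alternating (c : lie_line x) : lie_line_bracket c c = 0.
Proof. by []. Qed.
Fact lie_line_jacobi (a b c : lie_line x) :
  lie_line_bracket a (lie_line_bracket b c)
  + lie_line_bracket b (lie_line_bracket c a)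
  + lie_line_bracket c (lie_line_bracket a b) = 0.
Proof. by rewrite /lie_line_bracket !addr0. Qed.

HB.instance Definition _ := Lmodule_isLieAlgebra.Build K (lie_line x)
  lie_line_linearl lie_line_linearr lie_line_alternating lie_line_jacobi.

Definition lie_line_incl (c : lie_line x) : g := (c : K) *: x.

Lemma lie_line_incl_hom : lie_algebra_hom lie_line_incl.
Proof.
move=> a b; rewrite /lie_line_incl [in LHS]/lie_bracket /= /lie_line_bracket.
have ll0 : [lie 0, x] = 0.
  have /eqP := lie_linearl x 1 0 0.
  by rewrite !scale1r addr0 -subr_eq0 opprD addrA subrr add0r oppr_eq0 => /eqP.
have := lie_linearl x (a : K) x 0.
rewrite addr0 ll0 addr0 lie_alternating scaler0 linearZ /= => ->.
by rewrite scaler0 scale0r.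
Qed.

Section HornerExt.
Variables (A : algType K) (a : A).
Definition horner_ext : {poly K} -> A := horner_alg a.
HB.instance Definition _ := GRing.RMorphism.copy horner_ext (horner_alg a).
Fact horner_ext_scalable : scalable horner_ext.
Proof.
by move=> c p; rewrite -mul_polyC /horner_ext rmorphM /= horner_algC mulr_algl.
Qed.
HB.instance Definition _ := GRing.isScalable.Build K {poly K} A _ horner_ext
  horner_ext_scalable.
End HornerExt.

Definition lie_line_iota (c : lie_line x) : {poly K} := (c : K) *: 'X.

Fact lie_line_iota_linear : linear lie_line_iota.
Proof. by move=> a u v; rewrite /lie_line_iota scalerDl scalerA. Qed.
HB.instance Definition _ := GRing.isLinear.Build K (lie_line x) {poly K} _
  lie_line_iota lie_line_iota_linear.

Lemma lie_line_enveloping : is_enveloping_algebra lie_line_iota.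
Proof.
split=> [a b|A f _].
  by rewrite mulrC subrr; apply: (linear0 lie_line_iota).
exists (horner_ext (f (1 : K)) : {lrmorphism {poly K} -> A}); split=> [c|F' F'E p].
  rewrite /lie_line_iota linearZ /= /horner_ext horner_algX -linearZ /=.
  by congr (f _); apply: mulr1.
rewrite (poly_alg_initial F' p); congr (horner_alg _ p).
by rewrite -(F'E (1 : K)); congr (F' _); apply/esym; exact: scale1r.
Qed.
End LieLine.

(* A module over [g], seen as a module over [K[x] = U(K x)]: the variable acts
   as [x] does. *)
Definition res_line (K : comNzRingType) (g : lieAlgType K) (x : g)
  (M : lieModType g) : Type := M.

Section ResLine.
Variables (K : comNzRingType) (g : lieAlgType K) (x : g) (M : lieModType g).

HB.instance Definition _ := GRing.Zmodule.on (res_line x M).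

Definition res_scale (q : {poly K}) (v : res_line x M) : res_line x M :=
  \sum_(i < size q) q`_i *: iter i (lie_act x) (v : M).

Lemma res_scaleEw (n : nat) (q : {poly K}) (v : M) : (size q <= n)%N ->
  res_scale q v = \sum_(i < n) q`_i *: iter i (lie_act x) v.
Proof.
move=> le_qn; rewrite /res_scale.
rewrite (big_ord_widen n (fun i => q`_i *: iter i (lie_act x) v) le_qn).
rewrite big_mkcond; apply: eq_bigr => i _; case: ltnP => // /leq_sizeP -> //.
by rewrite scale0r.
Qed.

Lemma res_scaleC (c : K) (v : M) : res_scale c%:P v = c *: v.
Proof.
by rewrite (@res_scaleEw 1 _ _ (size_polyC_leq1 c)) big_ord1 coefC.
Qed.

Lemma res_scaleDl (v : M) : {morph res_scale^~ v : p q / p + q}.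
Proof.
move=> p q; have le_D := size_polyD p q.
rewrite (res_scaleEw _ le_D) (res_scaleEw v (leq_maxl (size p) (size q))).
rewrite (res_scaleEw v (leq_maxr (size p) (size q))) -big_split /=.
by apply: eq_bigr => i _; rewrite coefD scalerDl.
Qed.

Lemma res_scaleDr : right_distributive res_scale +%R.
Proof.
move=> q u v; rewrite /res_scale -big_split /=; apply: eq_bigr => i _.
rewrite -scalerDr; congr (_ *: _).
by elim: (i : nat) => //= k ->; rewrite linearD.
Qed.

Lemma res_scaleX (v : M) : res_scale 'X v = lie_act x v.
Proof.
rewrite /res_scale size_polyX !big_ord_recl big_ord0 !coefX /=.
by rewrite scale0r scale1r add0r addr0.
Qed.

Lemma res_scaleMX (q : {poly K}) (v : M) :
  res_scale (q * 'X) v = lie_act x (res_scale q v).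
Proof.
have le_qX : (size (q * 'X)%R <= (size q).+1)%N.
  by apply: leq_trans (size_polyMleq _ _) _; rewrite size_polyX addn2.
rewrite (res_scaleEw _ le_qX) big_ord_recl coefMX /= scale0r add0r.
rewrite /res_scale linear_sum /=; apply: eq_bigr => i _.
by rewrite coefMX /= linearZ.
Qed.

Lemma res_scaleZ (c : K) (q : {poly K}) (v : M) :
  res_scale (c *: q) v = c *: (res_scale q v : M).
Proof.
rewrite (res_scaleEw _ (size_scale_leq c q)) /res_scale scaler_sumr.
by apply: eq_bigr => i _; rewrite coefZ scalerA.
Qed.

Lemma res_scaleA (p q : {poly K}) (v : res_line x M) :
  res_scale p (res_scale q v) = res_scale (p * q) v.
Proof.
elim/poly_ind: p => [|p c IHp].
  by rewrite mul0r -polyC0 !res_scaleC !scale0r.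
rewrite mulrDl !res_scaleDl -mulrA ['X * q]mulrC mulrA !res_scaleMX IHp.
by rewrite mul_polyC res_scaleC res_scaleZ.
Qed.

Lemma res_scale1 : left_id 1 res_scale.
Proof. by move=> v; rewrite -polyC1 res_scaleC scale1r. Qed.

HB.instance Definition _ := GRing.Zmodule_isLmodule.Build {poly K}
  (res_line x M) res_scaleA res_scale1 res_scaleDr res_scaleDl.

(* The [U(K x)]-action does extend the action of the subalgebra [K x]. *)
Lemma res_line_iota (c : lie_line x) (v : res_line x M) :
  lie_line_iota c *: v = lie_act (lie_line_incl c) (v : M).
Proof.
rewrite [LHS]res_scaleZ res_scaleX /lie_line_incl.
have a0 : lie_act 0 (v : M) = 0.
  have /eqP := lie_act_linearl (v : M) 1 0 0.
  by rewrite !scale1r addr0 -subr_eq0 opprD addrA subrr add0r oppr_eq0 => /eqP.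
by have := lie_act_linearl (v : M) (c : K) x 0; rewrite !addr0 a0 addr0.
Qed.
End ResLine.

(** * Linear extension from a basis *)

(* The linear map sending the basis vector [<< b >>] to [h b]. *)
Fact lin_ext_key : unit. Proof. by []. Qed.
Definition lin_ext (K : nzRingType) (B : choiceType) (V : lmodType K) :
    (B -> V) -> {malg K[B]} -> V :=
  locked_with lin_ext_key (fun h x => \sum_(b <- msupp x) x@_b *: h b).

Section LinExt.
Variables (K : nzRingType) (B : choiceType) (V : lmodType K).

Lemma lin_extE (h : B -> V) (x : {malg K[B]}) :
  lin_ext h x = \sum_(b <- msupp x) x@_b *: h b.
Proof. by rewrite /lin_ext unlock. Qed.

Lemma lin_extEw (h : B -> V) (x : {malg K[B]}) (d : {fset B}) :
  (msupp x `<=` d)%fset -> lin_ext h x = \sum_(b <- d) x@_b *: h b.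
Proof.
move=> le_xd; rewrite lin_extE; apply: big_fset_incl => // b _ /mcoeff_outdom ->.
by rewrite scale0r.
Qed.

Lemma lin_ext_linear (h : B -> V) : linear (lin_ext h).
Proof.
move=> a x y; pose d := (msupp (a *: x + y) `|` (msupp x `|` msupp y))%fset.
have [le1 le2] : (msupp (a *: x + y) `<=` d)%fset /\ (msupp x `<=` d)%fset.
  by rewrite /d fsubsetUl fsubsetU // fsubsetUl orbT.
have le3 : (msupp y `<=` d)%fset by rewrite fsubsetU // fsubsetUr orbT.
rewrite (lin_extEw _ le1) (lin_extEw _ le2) (lin_extEw _ le3).
rewrite scaler_sumr -big_split /=; apply: eq_bigr => b _.
by rewrite mcoeffD mcoeffZ scalerDl scalerA.
Qed.
HB.instance Definition _ (h : B -> V) :=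
  GRing.isLinear.Build K {malg K[B]} V _ (lin_ext h) (lin_ext_linear h).

Lemma lin_extU (h : B -> V) (b : B) : lin_ext h << b >> = h b.
Proof.
by rewrite (lin_extEw _ msuppU_le) big_seq_fset1 mcoeffUU scale1r.
Qed.

Lemma lin_ext_linear_fun (W : lmodType K) (h : B -> W -> V) (x : {malg K[B]}) :
  (forall (a : K) b, a * x@_b = x@_b * a) ->
  (forall b, linear (h b)) -> linear (fun w => lin_ext (h^~ w) x).
Proof.
move=> comm hlin a u v; rewrite !lin_extE scaler_sumr -big_split /=.
by apply: eq_bigr => b _; rewrite hlin scalerDr !scalerA comm.
Qed.

Lemma malg_span (P : {malg K[B]} -> Prop) :
  (forall a x y, P x -> P y -> P (a *: x + y)) -> P 0 ->
  (forall b, P << b >>) -> forall x, P x.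
Proof.
move=> Plin P0 PB x; rewrite [x]monalgE; apply: big_ind => // [u v Pu Pv|b _].
  by rewrite -[u]scale1r; apply: Plin.
have -> : << x@_b *g b >> = x@_b *: << b >> + 0.
  by rewrite addr0; apply/malgP=> c; rewrite mcoeffZ !mcoeffU mulrnAr mulr1.
exact: Plin.
Qed.
End LinExt.

(** * The gap-[p] Virasoro algebra *)

(* The superscripts [1 <= i <= p - 1]. *)
Definition gap_sup (p : nat) : Type := {i : 'I_p | (0 < i)%N}.
HB.instance Definition _ p := Choice.on (gap_sup p).
Coercion gap_sup_nat p (i : gap_sup p) : nat := val (val i).

Inductive gap_basis (p : nat) : Type :=
| gapL of int
| gapI of gap_sup p & int
| gapC of 'I_(p./2).+1.

Arguments gapL {p} n.
Arguments gapI {p} i n.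
Arguments gapC {p} j.

Section GapChoice.
Variable p : nat.
Definition gap_basis_encode (b : gap_basis p) :
    int + gap_sup p * int + 'I_(p./2).+1 :=
  match b with
  | gapL n => inl (inl n) | gapI i n => inl (inr (i, n)) | gapC j => inr j
  end.
Definition gap_basis_decode (c : int + gap_sup p * int + 'I_(p./2).+1) :
    gap_basis p :=
  match c with
  | inl (inl n) => gapL n | inl (inr (i, n)) => gapI i n | inr j => gapC j
  end.
Fact gap_basis_encodeK : cancel gap_basis_encode gap_basis_decode.
Proof. by case. Qed.
HB.instance Definition _ := Choice.copy (gap_basis p) (can_type gap_basis_encodeK).
End GapChoice.

Definition gap_virasoro (F : numFieldType) (p : nat) : Type :=
  {malg F[gap_basis p]}.

HB.instance Definition _ (F : numFieldType) (p : nat) :=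
  GRing.Lmodule.on (gap_virasoro F p).

(* Locked, to keep unification from comparing finitely supported functions. *)
Fact gap_gen_key : unit. Proof. by []. Qed.
Definition gap_gen (F : numFieldType) (p : nat) : gap_basis p -> gap_virasoro F p :=
  locked_with gap_gen_key (fun b => << b >>).

Lemma gap_genE (F : numFieldType) (p : nat) (b : gap_basis p) :
  gap_gen F b = << b >>.
Proof. by rewrite /gap_gen unlock. Qed.

Section GapVirasoro.
Variables (F : numFieldType) (p : nat).
Local Notation g := (gap_virasoro F p).
Local Notation gen := (gap_gen F).

Definition Lgen (n : int) : g := gen (gapL n).
Definition Igen (i : gap_sup p) (n : int) : g := gen (gapI i n).
(* [C_i] for [0 <= i <= p - 1], with the convention [C_i = C_(p - i)] for
   [p./2 < i <= p - 1]. *)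
Definition Cgen (i : nat) : g := gen (gapC (inord (minn i (p - i)))).

Definition gap_bracket_basis (a b : gap_basis p) : g :=
  match a, b with
  | gapL m, gapL n =>
      (m - n)%:~R *: Lgen (m + n)
      + (if m + n == 0 then ((m ^+ 3 - m)%:~R / 12%:R) *: Cgen 0 else 0)
  | gapL m, gapI i n => - ((n%:~R + i%:R / p%:R) *: Igen i (m + n))
  | gapI i n, gapL m => (n%:~R + i%:R / p%:R) *: Igen i (m + n)
  | gapI i m, gapI j n =>
      if (i + j == p)%N && (m + n + 1 == 0)
      then (m%:~R + i%:R / p%:R) *: Cgen i else 0
  | gapC _, _ | _, gapC _ => 0
  end.

Definition gap_bracket (x y : g) : g :=
  lin_ext (fun a => lin_ext (gap_bracket_basis a) y) x.

Lemma gap_span (P : g -> Prop) :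
  (forall a x y, P x -> P y -> P (a *: x + y)) -> P 0 ->
  (forall b, P (gen b)) -> forall x, P x.
Proof.
move=> H H0 Hb; apply: malg_span => // b.
by have := Hb b; rewrite gap_genE.
Qed.

Lemma lin_ext_gen (V : lmodType F) (h : gap_basis p -> V) b :
  lin_ext h (gen b) = h b.
Proof. by rewrite gap_genE lin_extU. Qed.

Lemma gap_bracketE a b : gap_bracket (gen a) (gen b) = gap_bracket_basis a b.
Proof. by rewrite /gap_bracket !lin_ext_gen. Qed.

Lemma gap_linearl y : linear (gap_bracket^~ y).
Proof. exact: lin_ext_linear. Qed.

Lemma gap_linearr x : linear (gap_bracket x).
Proof.
apply: lin_ext_linear_fun => [a b|b]; first exact: mulrC.
exact: (lin_ext_linear (gap_bracket_basis b)).
Qed.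

Lemma gap_bracketDr x y z :
  gap_bracket x (y + z) = gap_bracket x y + gap_bracket x z.
Proof. by have := gap_linearr x 1 y z; rewrite !scale1r. Qed.
Lemma gap_bracket0r x : gap_bracket x 0 = 0.
Proof.
have /eqP := gap_bracketDr x 0 0.
by rewrite addr0 -[X in X == _]addr0 (inj_eq (addrI _)) eq_sym => /eqP.
Qed.
Lemma gap_bracketZr a x z : gap_bracket x (a *: z) = a *: gap_bracket x z.
Proof. by have := gap_linearr x a z 0; rewrite gap_bracket0r 2!addr0. Qed.
Lemma gap_bracketNr x z : gap_bracket x (- z) = - gap_bracket x z.
Proof. by rewrite -scaleN1r gap_bracketZr scaleN1r. Qed.
Lemma gap_bracket0l y : gap_bracket 0 y = 0.
Proof. exact: (linear0 (lin_ext _)). Qed.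
Lemma gap_bracketDl x y z :
  gap_bracket (x + y) z = gap_bracket x z + gap_bracket y z.
Proof. exact: (linearD (lin_ext _)). Qed.
Lemma gap_bracketZl a x z : gap_bracket (a *: x) z = a *: gap_bracket x z.
Proof. by rewrite /gap_bracket linearZ. Qed.

Lemma CgenC (i j : gap_sup p) : (i + j)%N = p -> Cgen i = Cgen j.
Proof.
move=> Eij; have Ei : (p - i = j)%N by rewrite -[X in (X - _)%N]Eij addKn.
have Ej : (p - j = i)%N by rewrite -[X in (X - _)%N]Eij addnK.
by rewrite /Cgen Ei Ej minnC.
Qed.

Lemma p_neq0 (i : gap_sup p) : p%:R != 0 :> F.
Proof. by rewrite pnatr_eq0 -lt0n (leq_ltn_trans (leq0n (val i))) // ltn_ord. Qed.

Lemma gap_coef (i j : gap_sup p) (m n : int) :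
  (i + j)%N = p -> m + n + 1 = 0 ->
  m%:~R + i%:R / p%:R = - (n%:~R + j%:R / p%:R) :> F.
Proof.
move=> Eij Emn; have p0 := p_neq0 i.
have -> : m = - (n + 1) by apply/eqP; rewrite -subr_eq0 opprK addrA Emn.
have -> : i%:R = p%:R - j%:R :> F by rewrite -[X in X%:R - _]Eij natrD addrK.
by rewrite rmorphN rmorphD /=; field.
Qed.

Lemma gap_anti_basis a b : gap_bracket_basis a b = - gap_bracket_basis b a.
Proof.
case: a b => [m|i m|k] [n|j n|l] /=; rewrite ?oppr0 ?opprK //; last first.
  rewrite [(j + i)%N]addnC [n + m]addrC.
  case: andP => [[/eqP Eij /eqP Emn]|_]; last by rewrite oppr0.
  by rewrite (gap_coef Eij Emn) (CgenC Eij) scaleNr.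
rewrite [n + m]addrC opprD -scaleNr -rmorphN opprB; congr (_ + _).
case: eqP => [/eqP|_]; last by rewrite oppr0.
rewrite addr_eq0 => /eqP ->; rewrite -scaleNr; congr (_ *: _).
by rewrite -mulNr -rmorphN; congr (_%:~R / _); ring.
Qed.

Lemma gap_anti x y : gap_bracket x y = - gap_bracket y x.
Proof.
elim/gap_span: x => [a u v IHu IHv||b].
- by rewrite gap_bracketDl gap_bracketZl gap_linearr IHu IHv scalerN opprD.
- by rewrite gap_bracket0l gap_bracket0r oppr0.
elim/gap_span: y => [a u v IHu IHv||c].
- by rewrite gap_bracketDl gap_bracketZl gap_linearr IHu IHv scalerN opprD.
- by rewrite gap_bracket0l gap_bracket0r oppr0.
by rewrite !gap_bracketE gap_anti_basis.
Qed.

Lemma gap_alternating x : gap_bracket x x = 0.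
Proof.
have E : 2%:R *: gap_bracket x x = 0.
  by rewrite scaler_nat mulr2n [X in X + _]gap_anti addNr.
have n2 : 2%:R != 0 :> F by rewrite pnatr_eq0.
by rewrite -[LHS]scale1r -(mulVf n2) -scalerA E scaler0.
Qed.

Definition gap_jac x y z : g :=
  gap_bracket x (gap_bracket y z) + gap_bracket y (gap_bracket z x)
  + gap_bracket z (gap_bracket x y).

Lemma gap_jacC x y z : gap_jac x y z = gap_jac y z x.
Proof. by rewrite /gap_jac -[LHS]addrA [LHS]addrC. Qed.

Lemma gap_central k x : gap_bracket x (gen (gapC k)) = 0.
Proof.
elim/gap_span: x => [a u v IHu IHv||b].
- by rewrite gap_bracketDl gap_bracketZl IHu IHv scaler0 addr0.
- exact: gap_bracket0l.
by rewrite gap_bracketE; case: b.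
Qed.

Lemma gap_jac_central k x y : gap_jac x y (gen (gapC k)) = 0.
Proof.
have Cl w : gap_bracket (gen (gapC k)) w = 0 by rewrite gap_anti gap_central oppr0.
by rewrite /gap_jac gap_central !Cl !gap_bracket0r !addr0.
Qed.

Let brLL m n : gap_bracket (Lgen m) (Lgen n) =
      (m - n)%:~R *: Lgen (m + n)
      + (if m + n == 0 then ((m ^+ 3 - m)%:~R / 12%:R) *: Cgen 0 else 0).
Proof. exact: gap_bracketE. Qed.
Let brLI m i n : gap_bracket (Lgen m) (Igen i n) =
   - ((n%:~R + i%:R / p%:R) *: Igen i (m + n)).
Proof. exact: gap_bracketE. Qed.
Let brIL m i n : gap_bracket (Igen i n) (Lgen m) =
   (n%:~R + i%:R / p%:R) *: Igen i (m + n).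
Proof. exact: gap_bracketE. Qed.
Let brII i j m n : gap_bracket (Igen i m) (Igen j n) =
      if (i + j == p)%N && (m + n + 1 == 0)
      then (m%:~R + i%:R / p%:R) *: Cgen i else 0.
Proof. exact: gap_bracketE. Qed.

Let scale_if (V : lmodType F) (a b : F) (t : bool) (v : V) :
  a *: (if t then b *: v else 0) = if t then (a * b) *: v else 0.
Proof. by case: t; rewrite ?scaler0 ?scalerA. Qed.
Let scale_comb (V : lmodType F) (a b c d e f : F) (v : V) :
  e * f + a * b - c * d = 0 ->
  - (a *: - (b *: v)) + c *: - (d *: v) + (e *: (f *: v) + 0) = 0.
Proof.
move=> E; rewrite !scalerN opprK !scalerA addr0 -scaleNr -!scalerDl.
by rewrite addrC addrA E scale0r.
Qed.
Let scale_swap (V : lmodType F) (a b : F) (v : V) :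
  a *: (b *: v) - b *: (a *: v) = 0.
Proof. by rewrite !scalerA mulrC subrr. Qed.

Let sum3 (A a B b C c : g) :
  A + a + (B + b) + (C + c) = A + B + C + (a + b + c).
Proof. by rewrite (addrACA A) (addrACA (A + B)). Qed.

Lemma gap_jacLLL m n k : gap_jac (Lgen m) (Lgen n) (Lgen k) = 0.
Proof.
have br a b c : gap_bracket (Lgen a) (gap_bracket (Lgen b) (Lgen c)) =
   (b - c)%:~R * (a - (b + c))%:~R *: Lgen (a + b + c) +
   (if a + b + c == 0 then (b - c)%:~R * ((a ^+ 3 - a)%:~R / 12%:R) *: Cgen 0
    else 0).
  rewrite -[a + b + c]addrA.
  rewrite brLL gap_bracketDr gap_bracketZr brLL scalerDr scalerA.
  rewrite [X in _ + X](_ : _ = 0) ?addr0; last first.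
    case: ifP => _; last by rewrite gap_bracket0r.
    by rewrite gap_bracketZr gap_central scaler0.
  by rewrite scale_if.
rewrite /gap_jac !br.
have -> : n + k + m = m + n + k by ring.
have -> : k + m + n = m + n + k by ring.
rewrite sum3 -!scalerDl.
rewrite [X in X *: _](_ : _ = 0); last by rewrite !(rmorphD, rmorphN) /=; ring.
rewrite scale0r add0r; case: eqP => [E0|_]; last by rewrite !addr0.
have -> : m = - (n + k) by apply/eqP; rewrite -subr_eq0 opprK addrA E0.
rewrite -!scalerDl [X in X *: _](_ : _ = 0) ?scale0r //.
by rewrite !(rmorphD, rmorphN, rmorphM, rmorphXn) /=; field.
Qed.

Lemma gap_jacLLI m n i k : gap_jac (Lgen m) (Lgen n) (Igen i k) = 0.
Proof.
rewrite /gap_jac brLI brIL brLL gap_bracketNr gap_bracketDr !gap_bracketZr !brLI brIL.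
rewrite [gap_bracket _ (if _ then _ else _)](_ : _ = 0); last first.
  case: ifP => _; last by rewrite gap_bracket0r.
  by rewrite gap_bracketZr gap_central scaler0.
have -> : n + (m + k) = m + (n + k) by ring.
have -> : m + n + k = m + (n + k) by ring.
apply: scale_comb.
by rewrite !(rmorphD, rmorphN) /=; field; exact: p_neq0 i.
Qed.

Lemma gap_jacLII m i n j k : gap_jac (Lgen m) (Igen i n) (Igen j k) = 0.
Proof.
rewrite /gap_jac brII brIL brLI gap_bracketNr !gap_bracketZr !brII.
rewrite [gap_bracket _ (if _ then _ else _)](_ : _ = 0); last first.
  case: ifP => _; last by rewrite gap_bracket0r.
  by rewrite gap_bracketZr gap_central scaler0.
rewrite add0r [(j + i)%N]addnC.
have -> : n + (m + k) + 1 = m + n + k + 1 by ring.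
have -> : k + (m + n) + 1 = m + n + k + 1 by ring.
rewrite !scale_if.
case: andP => [[/eqP Eij /eqP Emnk]|_]; last by rewrite subr0.
rewrite (CgenC Eij) [X in X *: _ - _]mulrC.
exact: subrr.
Qed.

Lemma gap_jacIII i m j n l k : gap_jac (Igen i m) (Igen j n) (Igen l k) = 0.
Proof.
have br x i' j' m' n' : gap_bracket x (gap_bracket (Igen i' m') (Igen j' n')) = 0.
  rewrite brII; case: ifP => _; last by rewrite gap_bracket0r.
  by rewrite gap_bracketZr gap_central scaler0.
by rewrite /gap_jac !br !addr0.
Qed.

Lemma gap_jac_linear x y : linear (gap_jac x y).
Proof.
move=> a u v; rewrite /gap_jac !gap_bracketDl !gap_bracketZl.
rewrite ![gap_bracket _ (a *: u + v)]gap_linearr !gap_linearr !scalerDr.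
exact: sum3.
Qed.

Lemma gap_jacobi x y z : gap_jac x y z = 0.
Proof.
have jlin u v : (forall b, gap_jac u v (gen b) = 0) -> forall w, gap_jac u v w = 0.
  move=> H; elim/gap_span => [a s t Es Et||//].
    by rewrite gap_jac_linear Es Et scaler0 addr0.
  have := gap_jac_linear u v (-1) 0 0.
  by rewrite scaler0 addr0 scaleN1r addNr.
have jB a b c : gap_jac (gen a) (gen b) (gen c) = 0.
  case: c => [k|l k|?]; last exact: gap_jac_central.
  - case: b => [n|j n|?]; last by rewrite 2!gap_jacC gap_jac_central.
    + case: a => [m|i m|?]; last by rewrite gap_jacC gap_jac_central.
      * exact: gap_jacLLL.
      * by rewrite gap_jacC; apply: gap_jacLLI.
    + case: a => [m|i m|?]; last by rewrite gap_jacC gap_jac_central.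
      * by rewrite 2!gap_jacC; apply: gap_jacLLI.
      * by rewrite 2!gap_jacC; apply: gap_jacLII.
  - case: b => [n|j n|?]; last by rewrite 2!gap_jacC gap_jac_central.
    + case: a => [m|i m|?]; last by rewrite gap_jacC gap_jac_central.
      * exact: gap_jacLLI.
      * by rewrite gap_jacC; apply: gap_jacLII.
    + case: a => [m|i m|?]; last by rewrite gap_jacC gap_jac_central.
      * exact: gap_jacLII.
      * exact: gap_jacIII.
apply: (jlin _ _) => c; rewrite gap_jacC; apply: (jlin _ _) => a; rewrite gap_jacC.
by apply: (jlin _ _) => b; rewrite gap_jacC.
Qed.

HB.instance Definition _ := Lmodule_isLieAlgebra.Build F g
  gap_linearl gap_linearr gap_alternating gap_jacobi.

Lemma lie_LL m n : [lie Lgen m, Lgen n] =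
  (m - n)%:~R *: Lgen (m + n)
  + (if m + n == 0 then ((m ^+ 3 - m)%:~R / 12%:R) *: Cgen 0 else 0).
Proof. exact: brLL. Qed.
Lemma lie_LI m i n : [lie Lgen m, Igen i n] =
  - ((n%:~R + i%:R / p%:R) *: Igen i (m + n)).
Proof. exact: brLI. Qed.
Lemma lie_II i j m n : [lie Igen i m, Igen j n] =
  if (i + j == p)%N && (m + n + 1 == 0)
  then (m%:~R + i%:R / p%:R) *: Cgen i else 0.
Proof. exact: brII. Qed.
Lemma lie_xC x i : [lie x, Cgen i] = 0.
Proof. exact: gap_central. Qed.
End GapVirasoro.

Lemma lie_line_L0_inj (F : numFieldType) (p : nat) :
  injective (@lie_line_incl F _ (Lgen F p 0)).
Proof.
rewrite /Lgen gap_genE => a b /(congr1 (mcoeff (gapL 0))).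
by rewrite !mcoeffZ !mcoeffUU !mulr1.
Qed.

(** * The modules [Omega(lambda, alpha)] *)

(* [alpha`_i] is [alpha_i] for [0 <= i <= p - 1]. *)
Definition Omega (F : numFieldType) (p : nat) (lambda : F) (lambda0 : lambda != 0)
  (alpha : p.-tuple F) : Type := {poly F}.

Section OmegaModule.
Variables (F : numFieldType) (p : nat) (lambda : F) (lambda0 : lambda != 0).
Variable alpha : p.-tuple F.
Local Notation W := (Omega lambda0 alpha).
Local Notation g := (gap_virasoro F p).
Local Notation gen := (gap_gen F).

HB.instance Definition _ := GRing.Lmodule.on W.

Definition omega_act_basis (b : gap_basis p) (f : W) : W :=
  match b with
  | gapL n => lambda ^ n *: (('X + (alpha`_0 * n%:~R)%:P) * (f \Po ('X + n%:~R%:P)))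
  | gapI i n => (alpha`_i * lambda ^ n) *: (f \Po ('X + (n%:~R + i%:R / p%:R)%:P))
  | gapC _ => 0
  end.

Definition omega_act (x : g) (f : W) : W :=
  lin_ext (fun b => omega_act_basis b f) x.

Lemma omega_actE b f : omega_act (gen b) f = omega_act_basis b f.
Proof. exact: lin_ext_gen. Qed.

Lemma omega_act_linearl f : linear (omega_act^~ f).
Proof. exact: lin_ext_linear. Qed.

Lemma omega_act_basis_linear b : linear (omega_act_basis b).
Proof.
move=> a f h; case: b => [n|i n|k] /=; last by rewrite scaler0 addr0.
- rewrite comp_polyD comp_polyZ mulrDr scalerDr -scalerAr.
  by congr (_ + _); rewrite !scalerA mulrC.
- rewrite comp_polyD comp_polyZ scalerDr.
  by congr (_ + _); rewrite !scalerA mulrC.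
Qed.

Lemma omega_act_linearr x : linear (omega_act x).
Proof.
apply: lin_ext_linear_fun => [a b|b]; first exact: mulrC.
exact: omega_act_basis_linear.
Qed.

Lemma omega_act0r x : omega_act x 0 = 0.
Proof.
by have := omega_act_linearr x (-1) 0 0;
  rewrite scaler0 addr0 scaleN1r addNr.
Qed.
Lemma omega_act0l f : omega_act 0 f = 0.
Proof. exact: (linear0 (lin_ext _)). Qed.
Lemma omega_actDl x y f : omega_act (x + y) f = omega_act x f + omega_act y f.
Proof. exact: (linearD (lin_ext _)). Qed.
Lemma omega_actZl a x f : omega_act (a *: x) f = a *: omega_act x f.
Proof. by rewrite /omega_act linearZ. Qed.
Lemma omega_actC i f : omega_act (Cgen F p i) f = 0.
Proof. exact: omega_actE. Qed.

Lemma shift_comp (f : {poly F}) (a b : F) :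
  (f \Po ('X + a%:P)) \Po ('X + b%:P) = f \Po ('X + (a + b)%:P).
Proof.
rewrite -comp_polyA comp_polyD comp_polyX comp_polyC -addrA -polyCD.
by rewrite [b + a]addrC.
Qed.

Lemma omega_bracket_basis a b f :
  omega_act (gap_bracket_basis F a b) f
  = omega_act_basis a (omega_act_basis b f) - omega_act_basis b (omega_act_basis a f).
Proof.
have LI m i n : omega_act_basis (gapL m) (omega_act_basis (gapI i n) f)
    - omega_act_basis (gapI i n) (omega_act_basis (gapL m) f)
  = - (n%:~R + i%:R / p%:R) *: omega_act_basis (gapI i (m + n)) f.
  rewrite /= !comp_polyZ comp_polyM !comp_polyD !comp_polyX !comp_polyC.
  rewrite !shift_comp.
  have -> : m%:~R + (n%:~R + i%:R / p%:R) = (m + n)%:~R + i%:R / p%:R :> F.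
    by rewrite rmorphD /= addrA.
  have -> : n%:~R + i%:R / p%:R + m%:~R = (m + n)%:~R + i%:R / p%:R :> F.
    by rewrite rmorphD /= addrC addrA.
  rewrite expfzDr // -!mul_polyC !(polyCM, polyCD, polyCN).
  by ring.
have B0 d : omega_act_basis d 0 = 0.
  by have := omega_act0r (gen d); rewrite omega_actE.
have A0 : omega_act 0 f = 0 := omega_act0l f.
case: a b => [m|i m|k] [n|j n|l].
- rewrite omega_actDl omega_actZl [X in _ + X](_ : _ = 0) ?addr0; last first.
    case: ifP => _; last exact: A0.
    by rewrite omega_actZl omega_actC scaler0.
  rewrite omega_actE /= !comp_polyZ !comp_polyM !comp_polyD !comp_polyX.
  rewrite !comp_polyC !shift_comp [n%:~R + m%:~R]addrC.
  rewrite !intrD mulrNz expfzDr //.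
  rewrite -!mul_polyC !(polyCM, polyCD, polyCN) /=; ring.
- by rewrite LI /gap_bracket_basis -scaleNr omega_actZl omega_actE.
- by rewrite A0 B0 subrr.
- by rewrite -[RHS]opprB LI scaleNr opprK /gap_bracket_basis omega_actZl
    omega_actE addrC.
- rewrite [LHS](_ : _ = 0); last first.
    rewrite /=; case: ifP => _; last exact: A0.
    by rewrite omega_actZl omega_actC scaler0.
  rewrite /= !comp_polyZ !shift_comp !scalerA.
  rewrite [n%:~R + j%:R / p%:R + _]addrC.
  by rewrite [alpha`_i * _ * _]mulrC subrr.
- by rewrite A0 B0 subrr.
- by rewrite A0 B0 subrr.
- by rewrite A0 B0 subrr.
- by rewrite A0 B0 subrr.
Qed.

Lemma omega_act_bracket x y f :
  omega_act [lie x, y] f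
  = omega_act x (omega_act y f) - omega_act y (omega_act x f).
Proof.
have lr z (a : F) (u v : W) : omega_act z (a *: u + v) = a *: omega_act z u + omega_act z v.
  exact: omega_act_linearr.
have sw (a : F) (u v u' v' : W) :
    a *: u + v - (a *: u' + v') = a *: (u - u') + (v - v').
  by rewrite scalerBr opprD addrACA.
rewrite -[[lie x, y]]/(gap_bracket x y).
elim/gap_span: x => [a u v IHu IHv||b].
- rewrite gap_bracketDl gap_bracketZl omega_actDl omega_actZl.
  by rewrite IHu IHv !omega_actDl !omega_actZl lr sw.
- by rewrite gap_bracket0l !omega_act0l omega_act0r subrr.
elim/gap_span: y => [a u v IHu IHv||c].
- rewrite gap_linearr omega_actDl omega_actZl.
  by rewrite IHu IHv !omega_actDl !omega_actZl lr sw.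
- by rewrite gap_bracket0r !omega_act0l omega_act0r subrr.
by rewrite gap_bracketE !omega_actE omega_bracket_basis.
Qed.

HB.instance Definition _ := Lmodule_isLieModule.Build F g W
  omega_act_linearl omega_act_linearr omega_act_bracket.

Lemma omega_LE n (f : W) : lie_act (Lgen F p n) f = 
  lambda ^ n *: (('X + (alpha`_0 * n%:~R)%:P) * (f \Po ('X + n%:~R%:P))).
Proof. exact: omega_actE. Qed.
Lemma omega_IE i n (f : W) : lie_act (Igen F i n) f =
  (alpha`_i * lambda ^ n) *: (f \Po ('X + (n%:~R + i%:R / p%:R)%:P)).
Proof. exact: omega_actE. Qed.
Lemma omega_CE j (f : W) : lie_act (Cgen F p j) f = 0.
Proof. exact: omega_actE. Qed.
End OmegaModule.

(* Main.v *)
From HB Require Import structures.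
Require Import Defs.
From mathcomp Require Import all_boot all_order all_algebra.
From mathcomp Require Import reals complex.
From mathcomp Require Import ring zify.

Import GRing.Theory Num.Theory.
Local Open Scope ring_scope.

(** Let [v] be a basis of [M] over [F['X] = U(F L_0)].  An element [x] with
[[L_0, x] = - s x] acts by [x (q v) = q('X + s) (x v)] ([lie_act_poly]), so it is
determined by its symbol, the polynomial [a x] with [x v = (a x) v].  On symbols
the Lie bracket becomes
  [a [x, y] = (a x) (a y)('X + s) - (a y) (a x)('X + t)],
where [s] and [t] are the weights of [x] and [y]; this is [shift_bracket].  The
theorem thus reduces to solving functional equations between polynomials.

They are solved by looking at leading terms.  If [a] and [q] have degrees [d] and
[e], the terms of degree [d + e] cancel in [shift_bracket s t a q], and the
coefficient of degree [d + e - 1] is the product of the leading coefficients times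
[e s - d t] ([size_coef_shift_bracket], [size_shift_bracket]).

- [[L_1, L_-1] = 2 L_0] forces the degrees of the symbols of [L_1] and [L_-1] to
  add up to 2.  One of them being constant contradicts [[L_2, L_-1] = 3 L_1] or
  [[L_1, L_-2] = 3 L_-1], so both have degree 1, which makes them
  [lambda ('X + alpha)] and [lambda^-1 ('X - alpha)] ([virasoro_symbols_pm1]).
- Bracketing with [L_-1] (or [L_1]) is injective on the symbols of positive
  (negative) weight, again by leading terms; so
  [[L_(n+1), L_-1] = (n + 2) L_n] and its mirror image determine all [L_n] from
  [L_0], [L_1] and [L_-1].  The central terms of these brackets
  vanish, because [m ^ 3 - m] does at [m = 1].  Then
  [[L_2, L_-2]] shows that [C_0] acts by zero ([virasoro_symbols]).
- For fixed [i], let [d] be the degree of the symbol of [I_0].  Going from [I_0] to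
  [I_1] with [L_1] and back with [L_-1] multiplies the leading coefficient by
  [(1 - d / w) (1 + d / (w + 1))] with [w = i / p]; this is 1, hence
  [d (d + 1) = 0] and the symbol is a constant.  One application of [L_n] then
  gives the symbol of [I_n] ([primary_symbols]).
- Constant symbols of the [I^(i)] make [[I^(i), I^(p - i)]] act by zero, and with
  it [C_i] ([gap_symbols]).

These are the symbols of [Omega(lambda, alpha)], and the coordinate map
[q v |-> q] is the isomorphism. *)

(** * The shift bracket and its leading coefficient *)

(** The commutator of the operators [f |-> a f('X + u)] and [f |-> q f('X + w)] is
[f |-> (shift_bracket u w a q) f('X + u + w)]. *)
Definition shift_bracket {F : nzRingType} (u w : F) (a q : {poly F}) : {poly F} :=
  a * (q \Po ('X + u%:P)) - q * (a \Po ('X + w%:P)).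

Lemma size_mulX_le {F : nzRingType} (r : {poly F}) (n : nat) :
  (size r <= n.-1)%N -> (0 < n)%N || (r == 0) -> (size (r * 'X)%R <= n)%N.
Proof.
have [-> _ _|r0] := eqVneq r 0; first by rewrite mul0r size_poly0.
by rewrite orbF size_mulX //; lia.
Qed.

(** Taylor expansion to first order: shifting keeps the leading term of [q], and
after subtracting [c *: q^`()] the error drops by one more degree.  Truncated
predecessors make the bounds say that the differences vanish for small sizes. *)
Lemma shift_taylor {F : comNzRingType} (c : F) (q : {poly F}) :
  (size (q \Po ('X + c%:P) - q)%R <= (size q).-1)%N /\
  (size (q \Po ('X + c%:P) - q - c *: q^`())%R <= (size q).-2)%N.
Proof.
elim/poly_ind: q => [|q k [IH1 IH2]].
  by rewrite comp_poly0 deriv0 scaler0 !subr0 size_poly0.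
rewrite size_MXaddC; case: ifP => [/andP[/eqP-> /eqP->]|_].
  by rewrite mul0r addr0 comp_poly0 deriv0 scaler0 !subr0 size_poly0.
have E1 : (q * 'X + k%:P) \Po ('X + c%:P) - (q * 'X + k%:P)
    = (q \Po ('X + c%:P) - q) * 'X + c *: (q \Po ('X + c%:P)).
  rewrite comp_polyD comp_polyM comp_polyX comp_polyC -mul_polyC; ring.
have E2 : (q * 'X + k%:P) \Po ('X + c%:P) - (q * 'X + k%:P)
     - c *: (q * 'X + k%:P)^`()
    = (q \Po ('X + c%:P) - q - c *: q^`()) * 'X + c *: (q \Po ('X + c%:P) - q).
  rewrite E1 derivD derivM derivX derivC -!mul_polyC; ring.
split.
  rewrite E1 (leq_trans (size_polyD _ _)) // geq_max; apply/andP; split.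
    apply: size_mulX_le => //=.
    have [->|/=] := eqVneq q 0; first by rewrite comp_poly0 subrr eqxx orbT.
    by rewrite -size_poly_gt0 => ->.
  apply: leq_trans (size_scale_leq _ _) _.
  rewrite -[q \Po _](subrK q).
  rewrite (leq_trans (size_polyD _ _)) // geq_max leqnn andbT.
  by rewrite (leq_trans IH1) // leq_pred.
rewrite E2 (leq_trans (size_polyD _ _)) // geq_max; apply/andP; split; last first.
  exact: leq_trans (size_scale_leq _ _) IH1.
apply: size_mulX_le => //=.
have [q1|q1] := leqP (size q) 1; last by rewrite -subn1 subn_gt0 q1.
rewrite -size_poly_leq0 (leq_trans IH2) ?orbT //.
by rewrite -2!subn1 -subnDA leq_subLR addn0 (leq_trans q1).
Qed.

Lemma coefM_top {F : nzRingType} (a q : {poly F}) (d e : nat) :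
  (size a <= d.+1)%N -> (size q <= e.+1)%N -> (a * q)`_(d + e) = a`_d * q`_e.
Proof.
move=> sa sq; have lt_d : (d < (d + e).+1)%N by lia.
rewrite coefM (bigD1 (Ordinal lt_d)) //= addKn big1 ?addr0 // => i.
rewrite -val_eqE /= => ne_id; have [lt_id|le_di] := ltnP i d.
  by rewrite [q`__]nth_default ?mulr0 // (leq_trans sq) //; lia.
by rewrite [a`__]nth_default ?mul0r // (leq_trans sa) //; lia.
Qed.

Lemma size_polyM_le {F : nzRingType} (a q : {poly F}) (m n : nat) :
  (size a <= m)%N -> (size q <= n)%N -> (size (a * q)%R <= (m + n).-1)%N.
Proof.
move=> sa sq; apply: leq_trans (size_polyMleq _ _) _.
by rewrite -!subn1 leq_sub2r // leq_add.
Qed.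

(** Subtracting [a * q] from both products leaves [a (q('X + u) - q)] and
[q (a('X + w) - a)], whose leading terms are those of [u a q'] and [w q a'] by
[shift_taylor].  When [d + e = 0] the bracket vanishes, and so does the right-hand
side of the second formula. *)
Lemma size_coef_shift_bracket {F : comNzRingType} (u w : F) (a q : {poly F})
    (d e : nat) : (size a <= d.+1)%N -> (size q <= e.+1)%N ->
  (size (shift_bracket u w a q) <= d + e)%N /\
  (shift_bracket u w a q)`_(d + e).-1 = a`_d * q`_e * (e%:R * u - d%:R * w).
Proof.
have half v (b r : {poly F}) k l : (size b <= k.+1)%N -> (size r <= l.+1)%N ->
    (size (b * (r \Po ('X + v%:P) - r))%R <= k + l)%N /\
    (b * (r \Po ('X + v%:P) - r))`_(k + l).-1 = b`_k * r`_l * (l%:R * v).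
  move=> sb sr; have [S1 S2] := shift_taylor v r.
  have {}S1 : (size (r \Po ('X + v%:P) - r)%R <= l)%N.
    by apply: leq_trans S1 _; rewrite -subn1 leq_subLR add1n.
  have {}S2 : (size (r \Po ('X + v%:P) - r - v *: r^`())%R <= l.-1)%N.
    by apply: leq_trans S2 _; rewrite -!subn1 leq_sub2r // leq_subLR add1n.
  case: l => [|l] in sr S1 S2 *.
    have /eqP -> : r \Po ('X + v%:P) - r == 0 by rewrite -size_poly_leq0.
    by rewrite mulr0 size_poly0 coef0 mul0r mulr0.
  split; first by rewrite (leq_trans (size_polyM_le _ _ _ _ sb S1)) //; lia.
  rewrite addnS /= -[_ \Po _ - r](subrK (v *: r^`())) mulrDr coefD.
  rewrite [X in X + _](_ : _ = 0) ?add0r; last first.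
    by rewrite nth_default // (leq_trans (size_polyM_le _ _ _ _ sb S2)) //; lia.
  rewrite -scalerAr coefZ coefM_top //; last first.
    have [->|r0] := eqVneq r 0; first by rewrite deriv0 size_poly0.
    by rewrite -ltnS (leq_trans (lt_size_deriv r0)).
  by rewrite coef_deriv -mulr_natl; ring.
move=> sa sq; have [A1 A2] := half u a q d e sa sq.
have [B1 B2] := half w q a e d sq sa.
have -> : shift_bracket u w a q =
   a * (q \Po ('X + u%:P) - q) - q * (a \Po ('X + w%:P) - a).
  by rewrite /shift_bracket; ring.
split; first by rewrite (leq_trans (size_polyD _ _)) // geq_max A1 size_polyN addnC.
by rewrite coefB A2 addnC B2; ring.
Qed.

Lemma size_shift_bracket {F : idomainType} (u w : F) (a q : {poly F}) :
  a != 0 -> q != 0 -> (size q).-1%:R * u - (size a).-1%:R * w != 0 ->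
  size (shift_bracket u w a q) = ((size a).-1 + (size q).-1)%N.
Proof.
rewrite -!size_poly_gt0 => sa sq neq0.
have [le_s] := size_coef_shift_bracket u w a q _ _ (leqSpred _) (leqSpred _).
rewrite -!lead_coefE => Ec; apply/eqP; rewrite eqn_leq le_s /=.
have : (shift_bracket u w a q)`_((size a).-1 + (size q).-1).-1 != 0.
  by rewrite Ec !mulf_neq0 // lead_coef_eq0 -size_poly_gt0.
apply: contraNT; rewrite -ltnNge => lt_s; apply/eqP/nth_default.
by rewrite -ltnS (leq_trans lt_s) ?leqSpred.
Qed.

(** * Symbols of the Virasoro algebra *)

Lemma shift_bracket0l {F : comNzRingType} (u w : F) q : shift_bracket u w 0 q = 0.
Proof. by rewrite /shift_bracket comp_poly0 mul0r mulr0 subrr. Qed.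
Lemma shift_bracket0r {F : comNzRingType} (u w : F) a : shift_bracket u w a 0 = 0.
Proof. by rewrite /shift_bracket comp_poly0 mul0r mulr0 subrr. Qed.
Lemma shift_bracketBl {F : comNzRingType} (u w : F) a b q :
  shift_bracket u w (a - b) q = shift_bracket u w a q - shift_bracket u w b q.
Proof. by rewrite /shift_bracket comp_polyB; ring. Qed.
Lemma shift_bracketBr {F : comNzRingType} (u w : F) a q r :
  shift_bracket u w a (q - r) = shift_bracket u w a q - shift_bracket u w a r.
Proof. by rewrite /shift_bracket comp_polyB; ring. Qed.

(** The symbol of [L_n] on [Omega(lambda, alpha)], at the basis vector 1. *)
Definition omega_symbol {F : numFieldType} (lambda alpha : F) (n : int) : {poly F} :=
  lambda ^ n *: ('X + (alpha * n%:~R)%:P).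

Lemma shift_bracket_omega {F : numFieldType} (lambda alpha : F) (m n : int) :
  lambda != 0 ->
  shift_bracket m%:~R n%:~R (omega_symbol lambda alpha m) (omega_symbol lambda alpha n)
  = (m - n)%:~R *: omega_symbol lambda alpha (m + n).
Proof.
move=> l0; rewrite /shift_bracket /omega_symbol !comp_polyZ !comp_polyD.
rewrite !comp_polyX !comp_polyC expfzDr // !rmorphD rmorphN /=.
by rewrite -!mul_polyC !(polyCM, polyCD, polyCN); ring.
Qed.

(** The brackets of the [L_n], with [a n] and [c] in the role of the symbols of
[L_n] and [C_0]. *)
Definition virasoro_relation {F : numFieldType} (a : int -> {poly F}) (c : {poly F}) :=
  forall m n : int, shift_bracket m%:~R n%:~R (a m) (a n) =
    (m - n)%:~R *: a (m + n)
    + (if m + n == 0 then ((m ^+ 3 - m)%:~R / 12%:R) *: c else 0).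

Lemma size2_polyE {F : fieldType} (r : {poly F}) : size r = 2 ->
  r = r`_1 *: ('X + (r`_0 / r`_1)%:P) /\ r`_1 != 0.
Proof.
move=> sr; have r1 : r`_1 != 0.
  by have := lead_coef_eq0 r; rewrite lead_coefE sr -size_poly_eq0 sr => ->.
split=> //; apply/polyP => i; rewrite coefZ coefD coefX coefC.
case: i => [|[|i]]; rewrite ?mulr1n ?addr0 ?mulr1 //=.
  by rewrite add0r mulrC divfK.
by rewrite nth_default ?sr // mulr0.
Qed.

(** The degrees [d] and [e] of [a 1] and [a (- 1)] satisfy [d + e = 2], since the
leading coefficient of their bracket carries the factor [d + e] and the bracket is
[2 'X].  If [d = 0], so that [e = 2], the leading coefficient of
[[L_2, L_-1] = 3 L_1] carries the factor [2 e + deg (a 2) > 0]: its left-hand side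
has positive degree and its right-hand side is constant.  The case [e = 0] is the
mirror image.  For [d = e = 1] the bracket is computed explicitly. *)
Lemma virasoro_symbols_pm1 {F : numFieldType} (a : int -> {poly F}) (c : {poly F}) :
  a 0 = 'X -> virasoro_relation a c -> exists lambda alpha : F,
  [/\ lambda != 0, a 1 = omega_symbol lambda alpha 1
     & a (- 1) = omega_symbol lambda alpha (- 1)].
Proof.
move=> a0 rel.
have R0 : shift_bracket 1 (- 1) (a 1) (a (- 1)) = 2%:R *: 'X.
  by have := rel 1 (- 1); rewrite /= expr1n !subrr mul0r scale0r addr0 a0.
have R1 : shift_bracket 2%:R (- 1) (a 2) (a (- 1)) = 3%:R *: a 1.
  by have := rel 2 (- 1); rewrite /= addr0.
have R2 : shift_bracket 1 (- 2%:R) (a 1) (a (- 2)) = 3%:R *: a (- 1).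
  by have := rel 1 (- 2); rewrite /= addr0.
have n2 : 2%:R != 0 :> F by rewrite pnatr_eq0.
have n3 : 3%:R != 0 :> F by rewrite pnatr_eq0.
have nz2X : 2%:R *: 'X != 0 :> {poly F} by rewrite scaler_eq0 negb_or n2 polyX_eq0.
have a1_0 : a 1 != 0.
  by apply: contra_eq_neq R0 => ->; rewrite shift_bracket0l eq_sym.
have am1_0 : a (- 1) != 0.
  by apply: contra_eq_neq R0 => ->; rewrite shift_bracket0r eq_sym.
have a2_0 : a 2 != 0.
  apply: contra_eq_neq R1 => ->.
  by rewrite shift_bracket0l eq_sym scaler_eq0 negb_or n3.
have am2_0 : a (- 2) != 0.
  apply: contra_eq_neq R2 => ->.
  by rewrite shift_bracket0r eq_sym scaler_eq0 negb_or n3.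
have degs : ((size (a 1)%R).-1 + (size (a (- 1))%R).-1)%N = 2.
  have [E|E] := eqVneq ((size (a 1)%R).-1 + (size (a (- 1))%R).-1)%N 0%N.
    have [] := size_coef_shift_bracket 1 (- 1) _ _ _ _
       (leqSpred (size (a 1))) (leqSpred (size (a (- 1)))).
    by rewrite E R0 size_scale // size_polyX.
  have := size_shift_bracket 1 (- 1) _ _ a1_0 am1_0.
  rewrite R0 size_scale // size_polyX => -> //.
  by rewrite mulrN opprK !mulr1 -natrD pnatr_eq0 addnC.
have s1 : size (a 1) != 1%N.
  apply/eqP => E; move: degs; rewrite E add0n => deg2.
  have := size_shift_bracket 2%:R (- 1) _ _ a2_0 am1_0.
  rewrite R1 size_scale // E deg2 mulrN mulr1 opprK -natrM -natrD pnatr_eq0.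
  by rewrite addn2 => /(_ isT).
have sm1 : size (a (- 1)) != 1%N.
  apply/eqP => E; move: degs; rewrite E addn0 => deg2.
  have := size_shift_bracket 1 (- 2%:R) _ _ a1_0 am2_0.
  rewrite R2 size_scale // E deg2 mulrN mulr1 opprK -natrM -natrD pnatr_eq0.
  by rewrite addnS add2n => /(_ isT).
have [sz1 szm1] : size (a 1) = 2 /\ size (a (- 1)) = 2.
  move: a1_0 am1_0 degs s1 sm1; rewrite -!size_poly_gt0.
  move: (size (a 1)) (size (a (- 1))) => k l; lia.
have [E1 l0] := size2_polyE _ sz1; have [Em1 _] := size2_polyE _ szm1.
move: (a 1)`_1 (_ / _) l0 E1 => l al l0 E1.
move: (a (- 1))`_1 (_ / _) Em1 => l' be Em1.
have R0' : (l * l') *: (2%:R *: 'X + (al + be)%:P) = 2%:R *: 'X :> {poly F}.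
  rewrite -[RHS]R0 E1 Em1 /shift_bracket !comp_polyZ !comp_polyD !comp_polyX.
  by rewrite !comp_polyC -!mul_polyC !(polyCM, polyCD, polyCN, polyC1, polyC_natr); ring.
have ll' : l * l' = 1.
  have /(congr1 (fun r : {poly F} => r`_1)) := R0'.
  rewrite !(coefZ, coefD, coefX, coefC) /= addr0 mulr1 => /eqP.
  rewrite -subr_eq0 -[X in _ - X]mul1r -mulrBl mulf_eq0 (negbTE n2) orbF.
  by rewrite subr_eq0 => /eqP.
have alK : be = - al.
  have /(congr1 (fun r : {poly F} => r`_0)) := R0'.
  rewrite !(coefZ, coefD, coefX, coefC) /= ll' mul1r mulr0 add0r => /eqP.
  by rewrite addrC addr_eq0 => /eqP.
exists l, al; split=> //; first by rewrite /omega_symbol mulr1.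
rewrite Em1 /omega_symbol alK mulrN mulr1 /exprz; congr (_ *: _).
by apply: (mulfI l0); rewrite ll' divff.
Qed.

Lemma size_omega_symbol {F : numFieldType} (lambda alpha : F) (n : int) :
  lambda != 0 -> size (omega_symbol lambda alpha n) = 2.
Proof. by move=> l0; rewrite size_scale ?expfz_neq0 // size_XaddC. Qed.

(** The difference between [a n] and [omega_symbol lambda alpha n] has zero bracket
with [omega_symbol lambda alpha (- 1)] when [n > 0] (by induction on [n]), while
[size_shift_bracket] gives this bracket the size of the difference; so the
difference is zero.  The case [n < 0] uses the bracket with
[omega_symbol lambda alpha 1]. *)
Lemma virasoro_symbols {F : numFieldType} (a : int -> {poly F}) (c : {poly F}) :
  a 0 = 'X -> virasoro_relation a c -> exists lambda alpha : F,
  [/\ lambda != 0, forall n, a n = omega_symbol lambda alpha n & c = 0].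
Proof.
move=> a0 rel; have [l [al [l0 a1E am1E]]] := virasoro_symbols_pm1 a c a0 rel.
exists l, al; pose om := omega_symbol l al.
rewrite -!/(om _) in a1E am1E.
have om0 n : om n != 0 by rewrite -size_poly_eq0 size_omega_symbol.
have pos (n : nat) : a n%:Z = om n%:Z.
  elim: n => [|n IH]; first by rewrite a0 /om /omega_symbol mulr0 addr0 scale1r.
  have R : shift_bracket n.+1%:R (- 1) (a n.+1 - om n.+1) (om (- 1)) = 0.
    rewrite shift_bracketBl -{1}am1E; apply/eqP; rewrite subr_eq0; apply/eqP.
    have := rel n.+1%:Z (- 1); have := shift_bracket_omega l al n.+1%:Z (- 1) l0.
    rewrite (_ : n.+1%:Z + - 1 = n%:Z); last by lia.
    rewrite IH mulrNz -!(pmulrn 1 n.+1) => -> ->.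
    (* The central term has total weight 0, where its coefficient [1 ^ 3 - 1] is 0. *)
    case: eqP => [n0|_]; last by rewrite addr0.
    by have -> : n = 0%N by [lia]; rewrite expr1n subrr mul0r scale0r addr0.
  apply/eqP; rewrite -subr_eq0; apply: contra_eqT R => nz.
  have := size_shift_bracket n.+1%:R (- 1) _ _ nz (om0 (- 1)).
  rewrite size_omega_symbol //= mul1r mulrN mulr1 opprK -natrD pnatr_eq0 addSn.
  by rewrite -size_poly_eq0 => -> //; rewrite addn1.
have neg (n : nat) : a (- n%:Z) = om (- n%:Z).
  elim: n => [|n IH]; first exact: (pos 0%N).
  have R : shift_bracket 1 (- n.+1%:R) (om 1) (a (- n.+1%:Z) - om (- n.+1%:Z)) = 0.
    rewrite shift_bracketBr -{1}a1E; apply/eqP; rewrite subr_eq0; apply/eqP.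
    have := rel 1 (- n.+1%:Z); have := shift_bracket_omega l al 1 (- n.+1%:Z) l0.
    rewrite (_ : 1 + - n.+1%:Z = - n%:Z); last by lia.
    rewrite IH mulrNz -!(pmulrn 1 n.+1) => -> ->.
    case: eqP => [n0|_]; last by rewrite addr0.
    by rewrite expr1n subrr mul0r scale0r addr0.
  apply/eqP; rewrite -subr_eq0; apply: contra_eqT R => nz.
  have := size_shift_bracket 1 (- n.+1%:R) _ _ (om0 1) nz.
  rewrite size_omega_symbol //= mul1r mulr1 opprK -natrD pnatr_eq0 addnS.
  by rewrite -size_poly_eq0 => ->.
have aE n : a n = om n by case: (intP n) => [|k|k]; rewrite ?(pos 0%N) ?pos ?neg.
split=> //; have := rel 2 (- 2); rewrite !aE.
rewrite [LHS]shift_bracket_omega //= -[X in X = _]addr0 => /addrI/esym/eqP.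
by rewrite scaler_eq0 mulf_eq0 invr_eq0 !pnatr_eq0 /= => /eqP.
Qed.

(** * Symbols of the primary fields [I^(i)] *)

(** Here [b n] is the symbol of [I_n^(i)] and [w = i / p].  The relations for
[L_1] on [b 0] and for [L_-1] on [b 1], read in degree [d = deg (b 0)], link the
top coefficients of [b 0] and [b 1] in two ways; eliminating that of [b 1] leaves
[d (d + 1) = 0]. *)
Lemma primary_symbols {F : numFieldType} (lambda alpha w : F) (b : int -> {poly F}) :
  lambda != 0 -> (forall n : int, n%:~R + w != 0) ->
  (forall m n : int, shift_bracket m%:~R (n%:~R + w) (omega_symbol lambda alpha m) (b n)
     = - ((n%:~R + w) *: b (m + n))) ->
  exists beta : F, forall n, b n = (beta * lambda ^ n)%:P.
Proof.
move=> l0 w0 rel; pose d := (size (b 0)).-1.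
have lead (m n : int) : (size (b n) <= d.+1)%N ->
     (size (b (m + n)%R) <= d.+1)%N /\
     lambda ^ m * (b n)`_d * (d%:R * m%:~R - (n%:~R + w))
       = - ((n%:~R + w) * (b (m + n))`_d).
  move=> sb.
  have [] := size_coef_shift_bracket m%:~R (n%:~R + w) (omega_symbol lambda alpha m)
    (b n) 1 d _ sb; first by rewrite size_omega_symbol.
  rewrite rel size_polyN size_scale // => le_s Ec; split=> //.
  move: Ec; rewrite coefN coefZ /= => ->.
  by rewrite coefZ coefD coefX coefC addr0 mulr1 mul1r.
have [s1 E1] := lead 1 0 (leqSpred _).
have [_ E0] := lead (- 1) 1 s1.
have b_const : b 0 = ((b 0)`_0)%:P.
  have [->|nz] := eqVneq (b 0) 0; first by rewrite coef0.
  have : (b 0)`_d * (d * d.+1)%:R = 0.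
    move: E1 E0; rewrite -[b (1 + 0)]/(b 1) -[b (- 1 + 1)]/(b 0).
    rewrite expr1z mulr0z add0r => E1 E0.
    have {}E0 : lambda^-1 * (b 1)`_d * (d%:R * (- 1) - (1 + w))
      = - ((1 + w) * (b 0)`_d) := E0.
    move: (b 0)`_d (b 1)`_d E1 E0 => x y E1 E0; apply: (mulfI l0); rewrite mulr0.
    have E0' : y * (d%:R + 1 + w) - lambda * ((1 + w) * x) = 0.
      by rewrite -[(1 + w) * x]opprK -E0; field.
    (* The right-hand side eliminates [y] between the two relations. *)
    transitivity ((lambda * x * (d%:R * 1 - w) + w * y) * (d%:R + 1 + w)
                  - w * (y * (d%:R + 1 + w) - lambda * ((1 + w) * x))).
      by rewrite natrM -addn1 natrD; ring.
    by rewrite E0' E1 addNr mul0r mulr0 subrr.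
  move/eqP; rewrite mulf_eq0 pnatr_eq0 muln_eq0 orbF /d -lead_coefE lead_coef_eq0.
  rewrite (negbTE nz) /= => /eqP d0; apply: size1_polyC.
  by rewrite (leq_trans (leqSpred _)) ?d0.
exists (b 0)`_0 => n; move: b_const; move: (b 0)`_0 => beta b_const.
have := rel n 0; rewrite addr0 b_const add0r /shift_bracket comp_polyC /omega_symbol.
rewrite comp_polyZ comp_polyD comp_polyX comp_polyC => E.
have w00 : w != 0 by rewrite -[w]add0r (w0 0).
apply: (scalerI w00); apply: oppr_inj; rewrite -E.
by rewrite -!mul_polyC !(polyCM, polyCD, polyCN); ring.
Qed.

(** * Symbols of a module of rank 1 *)

(** Since [0 < i < p], the weight [n + i / p] of [I_n^(i)] never vanishes. *)
Lemma gap_sup_noninteger {F : numFieldType} {p : nat} (i : gap_sup p) (n : int) :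
  n%:~R + i%:R / p%:R != 0 :> F.
Proof.
have p0 : p%:R != 0 :> F := p_neq0 F i.
apply/negP => /eqP /(congr1 ( *%R^~ p%:R)); rewrite mulrDl divfK // mul0r => E.
have /eqP : (n * p%:Z + i%:Z)%:~R = 0 :> F by rewrite rmorphD rmorphM /= -!pmulrn.
rewrite intr_eq0 => {E p0}; have := valP i; have := ltn_ord (val i).
rewrite /gap_sup_nat /=; case: (val i) => [j /= _] lt_jp j0 /eqP.
have [n0|n0] : (0 <= n \/ n <= -1)%R by lia.
  by nia.
by nia.
Qed.

Lemma lie_act0l {K : comNzRingType} {g : lieAlgType K} {M : lieModType g} (v : M) :
  lie_act 0 v = 0.
Proof.
by have := lie_act_linearl v (- 1) 0 0; rewrite scaler0 addr0 scaleN1r addNr.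
Qed.

Lemma lie_act_scalel {K : comNzRingType} {g : lieAlgType K} {M : lieModType g}
  (c : K) (x : g) (v : M) : lie_act (c *: x) v = c *: lie_act x v.
Proof. by have := lie_act_linearl v c x 0; rewrite !addr0 lie_act0l addr0. Qed.

(** The hypothesis says that [x x0 = (x0 + s) x] as operators on [M]; the formula
follows by induction on [q]. *)
Lemma lie_act_poly {K : comNzRingType} {g : lieAlgType K} {M : lieModType g}
    (x0 x : g) (s : K) : [lie x0, x] = - (s *: x) ->
  forall (q : {poly K}) (v : res_line x0 M),
    lie_act x (q *: v : M)
    = (q \Po ('X + s%:P)) *: (lie_act x (v : M) : res_line x0 M).
Proof.
move=> brk q v; pose N := res_line x0 M.
have actX (u : N) : 'X *: u = lie_act x0 (u : M) by exact: res_scaleX.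
have actC (c : K) (u : N) : c%:P *: u = (c *: (u : M) : M) by exact: res_scaleC.
have comm (u : M) : lie_act x (lie_act x0 u : M)
    = ('X + s%:P) *: (lie_act x u : N) :> N.
  rewrite scalerDl actX actC.
  have := lie_act_bracket x0 x u; rewrite brk => E.
  by rewrite -[LHS](subrK (lie_act x0 (lie_act x u))) -opprB -E -scaleNr
    lie_act_scalel scaleNr opprK addrC.
elim/poly_ind: q => [|q c IH].
  by rewrite comp_poly0 !scale0r; exact: (linear0 (lie_act x)).
rewrite comp_polyD comp_polyM comp_polyX comp_polyC !scalerDl.
rewrite (linearD (lie_act x)) /=.
congr (_ + _); last by rewrite !actC (linearZ_LR (lie_act x)).
by rewrite mulrC -scalerA actX comm IH scalerA mulrC.
Qed.

(** When [v] is a basis, exactly one [a] satisfies this, and [a x] is the coordinate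
of [x v]. *)
Definition is_symbol {K : comNzRingType} {g : lieAlgType K} {x0 : g}
    {M : lieModType g} (v : res_line x0 M) (a : g -> {poly K}) : Prop :=
  forall x, lie_act x (v : M) = a x *: v.

Lemma symbol_bracket {K : comNzRingType} {g : lieAlgType K} {M : lieModType g}
    (x0 x y : g) (s t : K) (v : res_line x0 M) (a : g -> {poly K}) :
  injective (fun q : {poly K} => q *: v) -> is_symbol v a ->
  [lie x0, x] = - (s *: x) -> [lie x0, y] = - (t *: y) ->
  a [lie x, y] = shift_bracket s t (a x) (a y).
Proof.
move=> inj aE brx bry; apply: inj; rewrite /= -aE lie_act_bracket !aE.
rewrite (lie_act_poly _ _ _ brx) (lie_act_poly _ _ _ bry) !aE !scalerA.
by rewrite -[LHS]scalerBl /shift_bracket [a x * _]mulrC [a y * _]mulrC.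
Qed.

Lemma symbol_linear {K : comNzRingType} {g : lieAlgType K} {M : lieModType g}
    (x0 : g) (v : res_line x0 M) (a : g -> {poly K}) :
  injective (fun q : {poly K} => q *: v) -> is_symbol v a -> linear a.
Proof.
move=> inj aE c x y; apply: inj; rewrite /= -aE lie_act_linearl !aE scalerDl.
by congr (_ + _); rewrite -mul_polyC -scalerA; apply/esym/res_scaleC.
Qed.

Lemma lie_L0_L (F : numFieldType) (p : nat) (n : int) :
  [lie Lgen F p 0, Lgen F p n] = - (n%:~R *: Lgen F p n).
Proof.
rewrite lie_LL sub0r rmorphN /= scaleNr add0r.
by case: eqP => [->|_]; rewrite ?expr0n ?subrr ?mul0r ?scale0r ?addr0.
Qed.

Lemma lie_L0_I (F : numFieldType) (p : nat) (i : gap_sup p) (n : int) :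
  [lie Lgen F p 0, Igen F i n] = - ((n%:~R + i%:R / p%:R) *: Igen F i n).
Proof. by rewrite lie_LI add0r. Qed.

Lemma lie_L0_C (F : numFieldType) (p : nat) (i : nat) :
  [lie Lgen F p 0, Cgen F p i] = - (0 *: Cgen F p i).
Proof. by rewrite lie_xC scale0r oppr0. Qed.

(** The minimum in [Cgen] is [k] because [k <= p / 2]. *)
Lemma gap_gen_C (F : numFieldType) (p : nat) (k : 'I_(p./2).+1) :
  gap_gen F (gapC k) = Cgen F p k.
Proof.
rewrite /Cgen (minn_idPl _) ?inord_val //.
by have := ltn_ord k; lia.
Qed.

(** The superscripts are [k] and [p - k]; the bracket of [I_0] and [I_-1] has the
nonzero coefficient [k / p] at [C_k]. *)
Lemma Cgen_commutator (F : numFieldType) (p : nat) (k : 'I_(p./2).+1) :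
  (1 < p)%N -> (0 < k)%N ->
  exists i j : gap_sup p,
    [lie Igen F i 0, Igen F j (- 1)] = (i%:R / p%:R) *: Cgen F p k.
Proof.
move=> p1 k0; have lt_kp : (k < p)%N by have := ltn_ord k; lia.
have lt_jp : (p - k < p)%N by lia.
have j0 : (0 < p - k)%N by lia.
exists (exist (fun i : 'I_p => (0 < i)%N) (Ordinal lt_kp) k0).
exists (exist (fun i : 'I_p => (0 < i)%N) (Ordinal lt_jp) j0).
by rewrite lie_II /gap_sup_nat /= subnKC ?eqxx ?add0r //= ltnW.
Qed.

(** The symbols of the generators on [M] are those on [Omega(lambda, alpha)] at
the vector 1, with [alpha_i] the constant symbol of [I_0^(i)].  The [C_k] with
[k > 0] vanish because constant symbols of opposite superscripts commute. *)
Lemma gap_symbols {F : numFieldType} {p : nat} (p_gt1 : (1 < p)%N)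
    (M : lieModType (gap_virasoro F p)) (v : res_line (Lgen F p 0) M)
    (a : gap_virasoro F p -> {poly F}) :
  injective (fun q : {poly F} => q *: v) -> is_symbol v a ->
  exists (lambda : F) (alpha : p.-tuple F), lambda != 0 /\
  [/\ forall n, a (Lgen F p n) = omega_symbol lambda alpha`_0 n,
      forall i n, a (Igen F i n) = (alpha`_i * lambda ^ n)%:P
    & forall k, a (gap_gen F (gapC k)) = 0].
Proof.
move=> inj aE; have a_lin := symbol_linear _ _ _ inj aE.
have a00 : a 0 = 0.
  by have := a_lin (- 1) 0 0; rewrite scaler0 addr0 scaleN1r addNr.
have aZ c x : a (c *: x) = c *: a x by rewrite -[c *: x]addr0 a_lin a00 addr0.
have aD x y : a (x + y) = a x + a y by rewrite -[x in LHS]scale1r a_lin scale1r.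
have aL0 : a (Lgen F p 0) = 'X.
  by apply: inj; rewrite /= -aE; apply/esym/res_scaleX.
have relL : virasoro_relation (fun n => a (Lgen F p n)) (a (Cgen F p 0)).
  move=> m n; rewrite -(symbol_bracket _ _ _ _ _ _ _ inj aE (lie_L0_L _ _ m)
     (lie_L0_L _ _ n)) lie_LL aD aZ.
  by case: ifP => _; rewrite ?aZ ?a00.
have [l [al [l0 LE C0]]] := virasoro_symbols _ _ aL0 relL.
have Iconst (i : gap_sup p) : exists beta, forall n,
    a (Igen F i n) = (beta * l ^ n)%:P.
  apply: (primary_symbols l al (i%:R / p%:R)) => // [n|m n].
    exact: gap_sup_noninteger.
  rewrite -LE -(symbol_bracket _ _ _ _ _ _ _ inj aE (lie_L0_L _ _ m)
     (lie_L0_I _ _ i n)) lie_LI.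
  by rewrite -scaleNr aZ scaleNr.
(* Entry 0 of the tuple belongs to the [L_n]; the index 0 is no superscript, which
   is what the inner [insub] detects. *)
pose al0 (i : nat) : F := if insub i is Some k then
    (if insub k is Some s then (a (Igen F (s : gap_sup p) 0))`_0 else al) else al.
exists l, (mktuple (fun i : 'I_p => al0 i)).
have alE i : (i < p)%N -> (mktuple (fun i : 'I_p => al0 i))`_i = al0 i.
  by move=> lt_ip; rewrite -(tnth_nth 0 _ (Ordinal lt_ip)) tnth_mktuple.
split=> //; split=> [n|i n|k].
- rewrite alE; last exact: ltnW.
  rewrite LE; congr (omega_symbol _ _ _).
  rewrite /al0; case: insubP => //= u _ u0.
  by case: insubP => //= s; rewrite u0.
- rewrite alE; last exact: ltn_ord.
  have -> : al0 i = (a (Igen F i 0))`_0.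
    by rewrite /al0 /gap_sup_nat valK /= valK.
  by have [beta E] := Iconst i; rewrite !E expr0z mulr1 coefC.
rewrite gap_gen_C; case: (posnP k) => [->|k0]; first exact: C0.
have [i [j E]] := Cgen_commutator F p k p_gt1 k0.
have := symbol_bracket _ _ _ _ _ _ _ inj aE (lie_L0_I _ _ i 0) (lie_L0_I _ _ j (- 1)).
have [bi Ei] := Iconst i; have [bj Ej] := Iconst j.
rewrite E aZ Ei Ej /shift_bracket !comp_polyC [X in _ - X]mulrC subrr => /eqP.
rewrite scaler_eq0 => /orP[/eqP i0|/eqP//].
by have := gap_sup_noninteger (F := F) i 0; rewrite i0 addr0 eqxx.
Qed.

(** * The classification *)

Theorem theorem4p1 (R : realType) (p : nat) (p_gt1 : (1 < p)%N)
    (M : lieModType (gap_virasoro R[i] p))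
    (M_free : free_rank1 (res_line (Lgen R[i] p 0) M)) :
  exists (lambda : R[i]) (lambda0 : lambda != 0) (alpha : p.-tuple R[i]),
    lie_module_iso M (Omega lambda0 alpha).
Proof.
have [v [h hK Kh]] := M_free.
(* [h] takes coordinates with respect to the basis [v]. *)
pose a x := h (lie_act x (v : M)).
have aE : is_symbol v a by move=> x; rewrite /a Kh.
have inj := can_inj hK.
have [l [al [l0 [LE IE CE]]]] := gap_symbols p_gt1 M v a inj aE.
exists l, l0, al; pose W := Omega l0 al.
have act (x : gap_virasoro R[i] p) : forall q : W,
    lie_act x (q *: v : M) = (lie_act x q : {poly R[i]}) *: v.
  elim/gap_span: x => [c x y IHx IHy q||b q].
  - rewrite !lie_act_linearl IHx IHy scalerDl -mul_polyC -scalerA.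
    by congr (_ + _); apply/esym/res_scaleC.
  - by move=> q; rewrite !lie_act0l scale0r.
  case: b => [n|i n|k].
  - rewrite -/(Lgen _ _ n) omega_LE (lie_act_poly _ _ _ (lie_L0_L _ _ n)).
    rewrite aE LE scalerA /omega_symbol; congr (_ *: v).
    by rewrite -scalerAr mulrC.
  - rewrite -/(Igen _ i n) omega_IE (lie_act_poly _ _ _ (lie_L0_I _ _ i n)).
    rewrite aE IE scalerA; congr (_ *: v).
    by rewrite mulrC mul_polyC.
  have aC := CE k; rewrite gap_gen_C in aC *.
  by rewrite omega_CE (lie_act_poly _ _ _ (lie_L0_C _ _ k)) aE aC !scale0r scaler0.
have h_lin : linear (h : M -> W).
  move=> c x y; apply: inj; rewrite /= Kh scalerDl -mul_polyC -scalerA !Kh.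
  by congr (_ + _); apply/esym/res_scaleC.
pose phi : {linear M -> W} := HB.pack (h : M -> W) (GRing.isLinear.Build _ _ _ _ _ h_lin).
exists phi; split; first by exists (fun q => q *: v).
move=> x u; apply: inj; rewrite /= Kh.
by rewrite -[in LHS](Kh u) act.
Qed.
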